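(* Let $j\in\{1,2,3,4\}$, let $\beta:I\to E_1^4$ be a unit-speed non-null curve with non-null Frenet frame $\{F_1,F_2,F_3,F_4\}$ such that $\varepsilon_j=g(F_j,F_j)=-1$ and $\varepsilon_i=g(F_i,F_i)=1$ for $i\neq j$ (so $\beta$ is timelike if $j=1$ and spacelike if $j=2,3,4$), and let $r:I\to(0,\infty)$ be a smooth radius function. (1) Let $\lambda\in\{1,-1\}$ and suppose $r'(s)^2>\lambda\varepsilon_1$ for all $s\in I$. The canal hypersurface $\mathfrak{C}^{\{j;\lambda\}}$ formed as the envelope of the family of pseudo hyperspheres (if $\lambda=1$), respectively pseudo hyperbolic hyperspheres (if $\lambda=-1$), with centers $\beta(s)$ and radii $r(s)$ can be parametrized by $$\mathfrak{C}^{\{j;\lambda\}}(s,t,w)=\beta(s)-\lambda\varepsilon_1 r(s)r'(s)F_1(s)\mp r(s)\sqrt{r'(s)^2-\lambda\varepsilon_1}\,\Big(\sum_{i=2}^{4}\mathfrak{a}_i(s,t,w)F_i(s)\Big),$$ where, for $j=1$, $$\mathfrak{a}_2=\cos t\cos w,\quad \mathfrak{a}_3=\sin t\cos w,\quad \mathfrak{a}_4=\sin w,$$ and, for $j=2,3,4$, $$\mathfrak{a}_j=\cosh t\cosh w,\quad \mathfrak{a}_{j+1}=\sinh w,\quad \mathfrak{a}_{j+2}=\sinh t\cosh w,$$ with the convention $\mathfrak{a}_5=\mathfrak{a}_2$, $\mathfrak{a}_6=\mathfrak{a}_3$. (2) For $j=2,3,4$, the canal hypersurfaces formed as the envelope of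 the family of null hypercones with vertices $\beta(s)$ can be parametrized by $$\mathfrak{C}^{\{j;0\}}(s,t,w)=\beta(s)\mp\Big(\sum_{i=2}^{4}a_i(s,t,w)F_i(s)\Big),$$ where $a_i(s,t,w)$ are arbitrary functions satisfying $\sum_{i=2}^{4}\varepsilon_i a_i^2(s,t,w)=0$. For $j=1$ (timelike center curve) the canal hypersurface $\mathfrak{C}^{\{1;0\}}$ cannot be defined.
   Context: $E_1^4$ is $\mathbb{R}^4$ with the inner product $g(x,y)=\langle x,y\rangle=-x_1y_1+x_2y_2+x_3y_3+x_4y_4$. For $p\in E_1^4$ and $r>0$: the pseudo hypersphere is $\{x:\langle x-p,x-p\rangle=r^2\}$, the pseudo hyperbolic hypersphere is $\{x:\langle x-p,x-p\rangle=-r^2\}$, the null hypercone is $\{x:\langle x-p,x-p\rangle=0\}$; these correspond to $\lambda=1,-1,0$ respectively in the equation $\langle x-p,x-p\rangle=\lambda r^2$. $I\subseteq\mathbb{R}$ is an open interval, $\beta$ is smooth with $\beta'=F_1$, $\langle\beta',\beta'\rangle=\pm1$, the $F_i$ are smooth and pairwise orthogonal with $g(F_i,F_i)=\varepsilon_i\in\{1,-1\}$, and the Frenet equations are $$F_1'=k_1F_2,\quad F_2'=\varepsilon_3\varepsilon_4k_1F_1+k_2F_3,\quad F_3'=\varepsilon_1\varepsilon_4k_2F_2+k_3F_4,\quad F_4'=\varepsilon_1\varepsilon_2k_3F_3,$$ with $k_1,k_2,k_3$ smooth functions on $I$ (the curvatures of $\beta$). The envelope of the family $\{x:\langle x-\beta(s),x-\beta(s)\rangle=\lambda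 r(s)^2\}_{s\in I}$ is taken in the usual sense: with $\Phi(x,s)=\langle x-\beta(s),x-\beta(s)\rangle-\lambda r(s)^2$, it consists of the points $x$ for which there is $s\in I$ with $\Phi(x,s)=0$ and $\partial\Phi/\partial s(x,s)=0$. (Equivalently, along a parametrization $X(s,t,w)$ with $\langle X-\beta(s),X-\beta(s)\rangle=\lambda r(s)^2$, the vector $X-\beta(s)$ is normal to the hypersurface.) The sign $\mp$ means that both signs are used. ''Cannot be defined'' means that there is no nonzero choice of $(a_2,a_3,a_4)$, so the envelope degenerates to the curve $\beta$. *)

(* Defs.v *)
From HB Require Import structures.
From mathcomp Require Import all_boot all_order all_algebra.
From mathcomp Require Import all_classical all_reals all_analysis.

Set Implicit Arguments.
Unset Strict Implicit.
Unset Printing Implicit Defensive.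

Import Order.TTheory GRing.Theory Num.Theory.
Import numFieldNormedType.Exports.

Local Open Scope classical_set_scope.
Local Open Scope ring_scope.

(* Indices are 0-based throughout: the index i : 'I_4 stands for the index
   i + 1 of the usual notation x_1, ..., x_4, F_1, ..., F_4, eps_1, ..., eps_4.
   In particular F 0 is the unit tangent. *)

Definition minkowski (R : realType) (x y : 'rV[R]_4) : R :=
  - (x 0 0 * y 0 0) + x 0 1 * y 0 1 + x 0 2 * y 0 2 + x 0 3 * y 0 3.

Definition cosh (R : realType) (x : R) : R := (expR x + expR (- x)) / 2.
Definition sinh (R : realType) (x : R) : R := (expR x - expR (- x)) / 2.

(* Functions on the open interval I are represented by total functions on R
   whose values outside I are irrelevant. *)
Definition smooth_on (R : realType) (V : normedModType R) (I : set R)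
    (f : R -> V) : Prop :=
  forall (n : nat) (s : R), I s -> derivable (derive1n n f) s 1.

Record frenet_curve (R : realType) (I : set R) (eps : 'I_4 -> R)
    (beta : R -> 'rV[R]_4) (F : 'I_4 -> R -> 'rV[R]_4)
    (k1 k2 k3 : R -> R) : Prop := FrenetCurve {
  smooth_curve : smooth_on I beta;
  smooth_frame : forall i, smooth_on I (F i);
  smooth_k1 : smooth_on I (k1 : R -> R^o);
  smooth_k2 : smooth_on I (k2 : R -> R^o);
  smooth_k3 : smooth_on I (k3 : R -> R^o);
  causal_sign : forall i, eps i = 1 \/ eps i = -1;
  frame_norm : forall i s, I s -> minkowski (F i s) (F i s) = eps i;
  frame_orth : forall i l s, I s -> i != l -> minkowski (F i s) (F l s) = 0;
  tangent : forall s, I s -> derive1 beta s = F 0 s;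
  frenet0 : forall s, I s -> derive1 (F 0) s = k1 s *: F 1 s;
  frenet1 : forall s, I s ->
    derive1 (F 1) s = (eps 2 * eps 3 * k1 s) *: F 0 s + k2 s *: F 2 s;
  frenet2 : forall s, I s ->
    derive1 (F 2) s = (eps 0 * eps 3 * k2 s) *: F 1 s + k3 s *: F 3 s;
  frenet3 : forall s, I s ->
    derive1 (F 3) s = (eps 0 * eps 1 * k3 s) *: F 2 s }.

(* The zero set of [quadric_family beta r lambda ^~ s] is the pseudo
   hypersphere (lambda = 1), the pseudo hyperbolic hypersphere (lambda = -1) or
   the null hypercone (lambda = 0) with center beta s and radius r s. *)
Definition quadric_family (R : realType) (beta : R -> 'rV[R]_4) (r : R -> R)
    (lambda : R) (x : 'rV[R]_4) (s : R) : R :=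
  minkowski (x - beta s) (x - beta s) - lambda * r s ^+ 2.

Definition characteristic (R : realType) (V : Type) (Phi : V -> R -> R)
    (s : R) : set V :=
  [set x | Phi x s = 0 /\ is_derive s (1 : R) (Phi x : R -> R^o) 0].

Definition envelope (R : realType) (V : Type) (I : set R) (Phi : V -> R -> R) :
    set V :=
  [set x | exists2 s, I s & characteristic Phi s x].

(* The parameter s of X is the parameter of the family. *)
Definition adapted (R : realType) (V : Type) (I : set R) (Phi : V -> R -> R)
    (X : R -> R -> R -> V) : Prop :=
  forall s t w, I s -> characteristic Phi s (X s t w).

(* The two signs of a "-/+" formula are indexed by a boolean: X false and
   X true together have to cover the envelope. *)
Definition parametrizes_envelope (R : realType) (V : Type) (I : set R)
    (Phi : V -> R -> R) (X : bool -> R -> R -> R -> V) : Prop :=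
  (forall b, adapted I Phi (X b)) /\
  envelope I Phi = [set x | exists b s t w, I s /\ x = X b s t w].

(* Sum over i = 2, 3, 4 in 1-based notation. *)
Definition normal_part (R : realType) (F : 'I_4 -> R -> 'rV[R]_4)
    (a : 'I_4 -> R -> R -> R -> R) (s t w : R) : 'rV[R]_4 :=
  \sum_(i < 4 | i != 0) a i s t w *: F i s.

(* In 1-based notation: 2 -> 3 -> 4 -> 2. *)
Definition cyc_next (j : 'I_4) : 'I_4 := if j == 3 then 1 else j + 1.

(* The value at i = 0 is never used. *)
Definition canal_coef (R : realType) (j i : 'I_4) (s t w : R) : R :=
  if j == 0 then
    if i == 1 then cos t * cos w
    else if i == 2 then sin t * cos w
    else sin w
  else
    if i == j then cosh t * cosh w
    else if i == cyc_next j then sinh w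
    else sinh t * cosh w.

Definition canal (R : realType) (j : 'I_4) (lambda : R) (eps : 'I_4 -> R)
    (beta : R -> 'rV[R]_4) (F : 'I_4 -> R -> 'rV[R]_4) (r : R -> R)
    (b : bool) (s t w : R) : 'rV[R]_4 :=
  beta s - (lambda * eps 0 * r s * derive1 r s) *: F 0 s
  - ((-1) ^+ b * (r s * Num.sqrt (derive1 r s ^+ 2 - lambda * eps 0)))
    *: normal_part F (canal_coef j) s t w.

Definition null_canal (R : realType) (beta : R -> 'rV[R]_4)
    (F : 'I_4 -> R -> 'rV[R]_4) (a : 'I_4 -> R -> R -> R -> R)
    (b : bool) (s t w : R) : 'rV[R]_4 :=
  beta s - (-1) ^+ b *: normal_part F a s t w.

Definition isotropic_coef (R : realType) (I : set R) (eps : 'I_4 -> R)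
    (a : 'I_4 -> R -> R -> R -> R) : Prop :=
  forall s t w, I s -> \sum_(i < 4 | i != 0) eps i * a i s t w ^+ 2 = 0.

(* Main.v *)
Require Import Defs.
From HB Require Import structures.
From mathcomp Require Import all_boot all_order all_algebra.
From mathcomp Require Import all_classical all_reals all_analysis.
From mathcomp Require Import ring lra.

Set Implicit Arguments.
Unset Strict Implicit.
Unset Printing Implicit Defensive.

Import Order.TTheory GRing.Theory Num.Theory.
Import numFieldNormedType.Exports.
Local Open Scope classical_set_scope.
Local Open Scope ring_scope.

(** In these comments the frame is numbered from 1, so that F_1 is the tangent.

    The s-derivative of the equation of the quadric centered at beta(s) is affine
    in x, with linear part given by beta' = F_1: the point x lies on the
    characteristic at s exactly when y = x - beta(s) satisfies
      <y, y> = lambda r^2   and   <y, F_1> = - lambda r r'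
    ([characteristic_quadricE]).  In the orthonormal frame F(s) the second
    equation fixes the tangential coordinate of y to be - lambda eps_1 r r', and
    the first one becomes a single quadratic equation on the three normal
    coordinates ([characteristic_frameE], with [frame_expansion] giving that
    every point has such coordinates):
      sum_{i >= 2} eps_i c_i^2 = lambda r^2 - eps_1 (lambda eps_1 r r')^2.

    For lambda = 1 or -1 the right-hand side is - eps_1 rho^2, where
    rho = r sqrt(r'^2 - lambda eps_1) is positive by hypothesis.  Dividing c by
    rho leaves the unit sphere if j = 1 and a two-sheeted hyperboloid of
    revolution around the j-th axis otherwise.  The coefficients a_i are
    spherical coordinates, respectively hyperbolic coordinates of the sheet
    a_j > 0, the opposite sign giving the other sheet ([spherical],
    [hyperboloid], [canal_coef_quadric], [canal_coef_surj]).

    For lambda = 0 the tangential coordinate vanishes and the equation is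
    sum_{i >= 2} eps_i c_i^2 = 0.  If j > 1 this is a cone, whose two nappes are
    graphs over the plane of the two spacelike coordinates ([null_coef_surj]);
    if j = 1 it is a sum of three squares and only the vertex beta(s) is left
    ([sum_sign0_eq0]). *)

(* The unqualified name refers to Minkowski's integral inequality. *)
Local Notation minkowski := Defs.minkowski.

(** * Sums over the normal indices *)

Lemma sum_ord4_neq0 (V : nmodType) (f : 'I_4 -> V) :
  \sum_(i < 4 | i != 0) f i = f 1 + f 2 + f 3.
Proof.
rewrite big_mkcond !big_ord_recl big_ord0 /= add0r addr0 addrA.
by congr (_ + _ + _); congr (f _); apply/val_inj.
Qed.

Lemma sum_ord4 (V : nmodType) (f : 'I_4 -> V) :
  \sum_(i < 4) f i = f 0 + \sum_(i < 4 | i != 0) f i.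
Proof. exact: bigD1. Qed.

Lemma forall_ord4_neq0 (P : 'I_4 -> Prop) :
  P 1 -> P 2 -> P 3 -> forall i, i != 0 -> P i.
Proof.
move=> P1 P2 P3 [[|[|[|[|//]]]] lti] // _.
- by rewrite (_ : Ordinal lti = 1) //; apply/val_inj.
- by rewrite (_ : Ordinal lti = 2) //; apply/val_inj.
- by rewrite (_ : Ordinal lti = 3) //; apply/val_inj.
Qed.

Lemma cyc_nextE : (cyc_next 1 = 2) * (cyc_next 2 = 3) * (cyc_next 3 = 1).
Proof. by split; [split|]; apply/val_inj. Qed.

(** Writing the three normal indices as j, its successor and the successor of
    that one treats the three spacelike cases of the center curve at once. *)
Lemma sum_ord4_cyc (V : nmodType) (j : 'I_4) (f : 'I_4 -> V) : j != 0 ->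
  \sum_(i < 4 | i != 0) f i =
  f j + f (cyc_next j) + f (cyc_next (cyc_next j)).
Proof.
rewrite sum_ord4_neq0; move: j; apply: forall_ord4_neq0; rewrite !cyc_nextE //.
  by rewrite -addrA addrC.
by rewrite addrC addrA.
Qed.

Lemma cyc_next_neq (j : 'I_4) : j != 0 ->
  [/\ cyc_next j != 0, cyc_next (cyc_next j) != 0, cyc_next j != j,
      cyc_next (cyc_next j) != j & cyc_next (cyc_next j) != cyc_next j].
Proof. by move: j; apply: forall_ord4_neq0. Qed.

Lemma forall_ord4_cyc (j : 'I_4) (P : 'I_4 -> Prop) : j != 0 ->
  P j -> P (cyc_next j) -> P (cyc_next (cyc_next j)) ->
  forall i, i != 0 -> P i.
Proof.
move: j; apply: forall_ord4_neq0; rewrite !cyc_nextE => ? ? ?;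
  exact: forall_ord4_neq0.
Qed.

(** * The Minkowski product and orthonormal frames *)

Section Minkowski.
Variable R : realType.
Implicit Types x y z : 'rV[R]_4.

Lemma minkowskiC x y : minkowski x y = minkowski y x.
Proof. by rewrite /minkowski; ring. Qed.

Lemma minkowskiDl x y z : minkowski (x + y) z = minkowski x z + minkowski y z.
Proof. by rewrite /minkowski !mxE; ring. Qed.

Lemma minkowskiZl (c : R) x y : minkowski (c *: x) y = c * minkowski x y.
Proof. by rewrite /minkowski !mxE; ring. Qed.

Lemma minkowskiNl x y : minkowski (- x) y = - minkowski x y.
Proof. by rewrite /minkowski !mxE; ring. Qed.

Lemma minkowski0l y : minkowski 0 y = 0.
Proof. by rewrite -(scale0r 0) minkowskiZl mul0r. Qed.

Lemma minkowski_suml (f : 'I_4 -> 'rV[R]_4) y :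
  minkowski (\sum_i f i) y = \sum_i minkowski (f i) y.
Proof.
elim/big_rec2: _ => [|i c x _ <-]; first exact: minkowski0l.
exact: minkowskiDl.
Qed.

Definition minkowski_gram : 'M[R]_4 := diag_mx (\row_i (-1) ^+ (i == 0)).

Lemma minkowski_gramE m n (A : 'M[R]_(m, 4)) (B : 'M[R]_(n, 4)) i l :
  (A *m minkowski_gram *m B^T) i l = minkowski (row i A) (row l B).
Proof.
rewrite mxE sum_ord4 sum_ord4_neq0 /minkowski /minkowski_gram.
rewrite mul_mx_diag !mxE /=.
by rewrite expr1 expr0 mulrN1 mulNr !mulr1 !addrA.
Qed.

Section Frame.
Variables (e : 'I_4 -> R) (f : 'I_4 -> 'rV[R]_4).
Hypothesis e_sq : forall i, e i * e i = 1.
Hypothesis f_orth : forall i l, minkowski (f i) (f l) = e i *+ (i == l).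

(** In matrix form, orthonormality reads M G M^T E = 1, where M has the rows
    f_i, G is the Gram matrix of the product and E = diag(e).  A right inverse of a
    square matrix is a left inverse, so that also G M^T E M = 1, which is the
    claim. *)
Lemma frame_expansion y : y = \sum_i (e i * minkowski y (f i)) *: f i.
Proof.
pose M := \matrix_i f i.
pose N := minkowski_gram *m M^T *m diag_mx (\row_i e i).
have MN : M *m N = 1%:M.
  rewrite /N !mulmxA; apply/matrixP => i l; rewrite mul_mx_diag mxE.
  rewrite minkowski_gramE !rowK f_orth !mxE.
  by case: eqP => [->|_]; rewrite ?mulr1n ?mulr0n ?mul0r ?e_sq.
rewrite -[LHS]mulmx1 -(mulmx1C MN) !mulmxA mulmx_sum_row.
apply: eq_bigr => i _; rewrite rowK mul_mx_diag mxE minkowski_gramE mxE.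
by rewrite rowK row_id mulrC.
Qed.

Lemma minkowski_frame_coord (c : 'I_4 -> R) l :
  minkowski (\sum_i c i *: f i) (f l) = e l * c l.
Proof.
rewrite minkowski_suml (bigD1 l) //= big1 => [|i il].
  by rewrite minkowskiZl f_orth eqxx addr0 mulrC.
by rewrite minkowskiZl f_orth (negbTE il) mulr0n mulr0.
Qed.

Lemma minkowski_frame_norm (c : 'I_4 -> R) :
  minkowski (\sum_i c i *: f i) (\sum_i c i *: f i) = \sum_i e i * c i ^+ 2.
Proof.
rewrite {1}minkowski_suml; apply: eq_bigr => i _.
by rewrite minkowskiZl minkowskiC minkowski_frame_coord; ring.
Qed.

End Frame.

Lemma is_derive_coord (f : R -> 'rV[R]_4) (s : R) (df : 'rV[R]_4) k :
  is_derive s 1 f df -> is_derive s 1 (fun u => f u 0 k : R^o) (df 0 k).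
Proof.
move=> [dvf <-]; have dvk := (derivable_mxP _ _ _).1 dvf 0 k.
by split=> //; rewrite derive_mx // mxE.
Qed.

Lemma is_derive_minkowski (f g : R -> 'rV[R]_4) (s : R) (df dg : 'rV[R]_4) :
  is_derive s 1 f df -> is_derive s 1 g dg ->
  is_derive s 1 (fun u => minkowski (f u) (g u) : R^o)
    (minkowski df (g s) + minkowski (f s) dg).
Proof.
move=> Df Dg; rewrite /minkowski.
have Df' k := is_derive_coord k Df.
have Dg' k := is_derive_coord k Dg.
apply: is_derive_eq; rewrite /GRing.scale /=; ring.
Qed.

End Minkowski.

(** * Coordinates on the circle, the sphere and the hyperboloid *)

Section Coordinates.
Variable R : realType.
Implicit Types t u v w x y z : R.

Lemma polar u v : u ^+ 2 + v ^+ 2 = 1 -> exists t, u = cos t /\ v = sin t.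
Proof.
move=> uv1; have u1 : -1 <= u <= 1.
  by rewrite -ler_norml -(@expr_le1 _ 2) // real_normK ?num_real //
     -uv1 lerDl sqr_ge0.
have cosu : cos (acos u) = u by rewrite acosK // in_itv.
have sinu : sin (acos u) = `|v|.
  by rewrite sin_acos // (_ : 1 - u ^+ 2 = v ^+ 2) ?sqrtr_sqr // -uv1; ring.
case: (ger0P v) sinu => _ sinu; first by exists (acos u).
by exists (- acos u); rewrite cosN sinN cosu sinu opprK.
Qed.

Lemma spherical x y z : x ^+ 2 + y ^+ 2 + z ^+ 2 = 1 ->
  exists t w, [/\ x = cos t * cos w, y = sin t * cos w & z = sin w].
Proof.
move=> xyz1; set c := Num.sqrt (x ^+ 2 + y ^+ 2).
have c2 : c ^+ 2 = x ^+ 2 + y ^+ 2 by rewrite sqr_sqrtr // addr_ge0 ?sqr_ge0.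
have [|w [cw ->]] := @polar c z; first by rewrite c2.
have [c0|c0] := eqVneq c 0.
  (* at the poles cos w = 0 and every t will do *)
  move/eqP: c2; rewrite c0 expr0n /= eq_sym paddr_eq0 ?sqr_ge0 // !sqrf_eq0.
  by move=> /andP[/eqP-> /eqP->]; exists 0, w; rewrite -cw c0 !mulr0.
have [|t [ct st]] := @polar (x / c) (y / c).
  by rewrite !expr_div_n -mulrDl -c2 divff // sqrf_eq0.
by exists t, w; rewrite -ct -st -cw !divfK.
Qed.

Lemma cosh_gt0 x : 0 < cosh x.
Proof. by rewrite divr_gt0 // addr_gt0 ?expR_gt0. Qed.

Lemma cosh2E x : cosh x ^+ 2 = 1 + sinh x ^+ 2.
Proof. by rewrite -[1](expRxMexpNx_1 x) /cosh /sinh; field. Qed.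

Lemma sinh_surj x : exists w, sinh w = x.
Proof.
set c := Num.sqrt (x ^+ 2 + 1).
have c2 : c ^+ 2 = x ^+ 2 + 1 by rewrite sqr_sqrtr // addr_ge0 ?sqr_ge0.
have c0 : 0 < c by rewrite sqrtr_gt0 ltr_wpDl ?sqr_ge0.
have xc : 0 < x + c by nra.
(* x + c is the positive root of y - 1/y = 2 x *)
exists (ln (x + c)); rewrite /sinh expRN lnK ?posrE //.
have -> : (x + c)^-1 = c - x.
  apply: (mulfI (lt0r_neq0 xc)); rewrite divff ?gt_eqF //.
  by transitivity (c ^+ 2 - x ^+ 2); [rewrite c2|]; ring.
by field.
Qed.

(** Since cosh w never vanishes, y determines w and then z determines t; the
    equation gives x up to sign, and the sign is that of cosh t cosh w. *)
Lemma hyperboloid x y z : - x ^+ 2 + y ^+ 2 + z ^+ 2 = -1 -> 0 <= x ->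
  exists t w, [/\ x = cosh t * cosh w, y = sinh w & z = sinh t * cosh w].
Proof.
move=> xyz x0; have [w sw] := sinh_surj y.
have cw0 := cosh_gt0 w; have [t st] := sinh_surj (z / cosh w).
have zE : z = sinh t * cosh w by rewrite st divfK ?gt_eqF.
exists t, w; split=> //; apply/eqP.
rewrite -(@eqrXn2 _ 2) ?mulr_ge0 ?(ltW cw0) ?(ltW (cosh_gt0 t)) //; apply/eqP.
rewrite zE exprMn in xyz.
have -> : x ^+ 2 = y ^+ 2 + sinh t ^+ 2 * cosh w ^+ 2 + 1.
  by lra.
by rewrite [RHS]exprMn !cosh2E sw; ring.
Qed.
End Coordinates.

(** * Characteristics of a family of quadrics in an orthonormal frame *)

Section Characteristic.
Variable R : realType.
Variables (beta : R -> 'rV[R]_4) (r : R -> R) (lambda s dr : R).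
Variables (e : 'I_4 -> R) (f : 'I_4 -> 'rV[R]_4).
Hypothesis e_sq : forall i, e i * e i = 1.
Hypothesis f_orth : forall i l, minkowski (f i) (f l) = e i *+ (i == l).
Hypothesis Dbeta : is_derive s 1 beta (f 0).
Hypothesis Dr : is_derive s 1 (r : R -> R^o) dr.

Local Notation center_shift := (lambda * e 0 * r s * dr).

(** The first frame vector is the velocity of the center curve at s, so the
    moving center contributes - 2 <x - beta, f_1>. *)
Lemma is_derive_quadric_family x :
  is_derive s 1 (quadric_family beta r lambda x : R -> R^o)
    (- 2 * (minkowski (x - beta s) (f 0) + lambda * r s * dr)).
Proof.
have Dx : is_derive s 1 (fun u => x - beta u) (- f 0).
  by apply: is_derive_eq; rewrite sub0r.
have Dm := is_derive_minkowski Dx Dx.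
rewrite /quadric_family; apply: is_derive_eq.
rewrite minkowskiNl [minkowski _ (- _)]minkowskiC minkowskiNl.
rewrite [minkowski (f 0) _]minkowskiC /GRing.scale /=; ring.
Qed.

Lemma characteristic_quadricE x :
  characteristic (quadric_family beta r lambda) s x <->
  minkowski (x - beta s) (x - beta s) = lambda * r s ^+ 2 /\
  minkowski (x - beta s) (f 0) = - (lambda * r s * dr).
Proof.
have DPhi := is_derive_quadric_family x; split=> [[Phi0 DPhi0]|[norm_x tan_x]].
  split; first by apply/eqP; rewrite -subr_eq0; apply/eqP.
  have := @derive_val _ _ _ _ _ _ _ DPhi; rewrite derive_val => /esym/eqP.
  rewrite mulf_eq0 oppr_eq0 pnatr_eq0 /= addr_eq0 => /eqP //.
split; first by rewrite /quadric_family norm_x subrr.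
by apply: is_derive_eq; rewrite tan_x addNr mulr0.
Qed.

(** The tangential condition holds by the choice of the first coordinate, so
    that only the quadratic equation on the normal coordinates remains. *)
Lemma characteristic_frameE (m : R) (a : 'I_4 -> R) :
  characteristic (quadric_family beta r lambda) s
    (beta s - center_shift *: f 0 - m *: \sum_(i < 4 | i != 0) a i *: f i) <->
  m ^+ 2 * \sum_(i < 4 | i != 0) e i * a i ^+ 2 =
  lambda * r s ^+ 2 - e 0 * center_shift ^+ 2.
Proof.
pose c i := if i == 0 then - center_shift else - m * a i.
rewrite characteristic_quadricE.
have -> : beta s - center_shift *: f 0
    - m *: (\sum_(i < 4 | i != 0) a i *: f i) - beta s = \sum_i c i *: f i.
  rewrite sum_ord4 /c eqxx scaleNr scaler_sumr -sumrN addrAC [beta s + _]addrC.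
  rewrite addrK; congr (_ + _); apply: eq_bigr => i /negbTE ->.
  by rewrite scalerA mulNr scaleNr.
rewrite (minkowski_frame_norm f_orth) (minkowski_frame_coord f_orth).
rewrite sum_ord4 {1 2}/c !eqxx.
have -> : \sum_(i < 4 | i != 0) e i * c i ^+ 2 =
    m ^+ 2 * \sum_(i < 4 | i != 0) e i * a i ^+ 2.
  by rewrite mulr_sumr; apply: eq_bigr => i /negbTE i0; rewrite /c i0; ring.
have -> : e 0 * - center_shift = - (lambda * r s * dr).
  by rewrite -[RHS]mulr1 -(e_sq 0); ring.
by split=> [[<- _]|H]; [ring | split=> //; rewrite H; ring].
Qed.

(** The coordinates of y in the frame, in the scaling of
    [characteristic_frameE], where they enter multiplied by - m. *)
Definition frame_coef (m : R) (y : 'rV[R]_4) (i : 'I_4) : R :=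
  - m^-1 * (e i * minkowski y (f i)).

Lemma characteristic_frame_coef (m : R) x : m != 0 ->
  characteristic (quadric_family beta r lambda) s x ->
  x = beta s - center_shift *: f 0
      - m *: \sum_(i < 4 | i != 0) frame_coef m (x - beta s) i *: f i.
Proof.
move=> m0 /characteristic_quadricE [_ tan_x].
rewrite -[LHS](subrK (beta s)) addrC -!addrA; congr (_ + _).
rewrite [LHS](frame_expansion e_sq f_orth) sum_ord4 tan_x.
congr (_ + _).
  by rewrite -[RHS]scaleNr; congr (_ *: _); ring.
rewrite scaler_sumr -sumrN; apply: eq_bigr => i _.
by rewrite scalerA -scaleNr /frame_coef mulrA mulrN divff // mulN1r opprK.
Qed.
End Characteristic.

(** * Parametrizing the quadrics of normal coordinates *)

Section Quadrics.
Variables (R : realType) (j : 'I_4) (e : 'I_4 -> R).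
Hypothesis e_j : e j = -1.
Hypothesis e_other : forall i, i != j -> e i = 1.

Lemma sum_sign_cyc (c : 'I_4 -> R) : j != 0 ->
  \sum_(i < 4 | i != 0) e i * c i ^+ 2 =
  - c j ^+ 2 + c (cyc_next j) ^+ 2 + c (cyc_next (cyc_next j)) ^+ 2.
Proof.
move=> j0; have [_ _ nj nnj _] := cyc_next_neq j0.
by rewrite (sum_ord4_cyc _ j0) e_j !e_other // mulN1r !mul1r.
Qed.

Lemma sum_sign0 (c : 'I_4 -> R) : j = 0 ->
  \sum_(i < 4 | i != 0) e i * c i ^+ 2 = c 1 ^+ 2 + c 2 ^+ 2 + c 3 ^+ 2.
Proof. by move=> j0; rewrite sum_ord4_neq0 !e_other ?j0 // !mul1r. Qed.

Lemma canal_coef_quadric s t w :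
  \sum_(i < 4 | i != 0) e i * canal_coef j i s t w ^+ 2 = - e 0.
Proof.
have [j0|j0] := eqVneq j 0.
  rewrite sum_sign0 // /canal_coef j0 /= -{1}j0 e_j opprK.
  have := cos2Dsin2 t; have := cos2Dsin2 w; move=> Hw Ht.
  by rewrite !exprMn -mulrDl Ht mul1r.
have [_ _ /negbTE nj /negbTE nnj /negbTE nnn] := cyc_next_neq j0.
rewrite sum_sign_cyc // e_other 1?eq_sym // /canal_coef (negbTE j0).
rewrite !eqxx nj nnj nnn.
rewrite [(cosh t * _) ^+ 2]exprMn [(sinh t * _) ^+ 2]exprMn.
by rewrite !cosh2E; ring.
Qed.

(** For j = 1 the spherical coordinates already cover the sphere with one sign;
    for j > 1 each sign covers one sheet. *)
Lemma canal_coef_surj (c : 'I_4 -> R) s :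
  \sum_(i < 4 | i != 0) e i * c i ^+ 2 = - e 0 ->
  exists (b : bool) t w,
    forall i, i != 0 -> c i = (-1) ^+ b * canal_coef j i s t w.
Proof.
have [j0|j0] := eqVneq j 0.
  rewrite sum_sign0 // -{1}j0 e_j opprK => /spherical[t [w [c1 c2 c3]]].
  exists false, t, w; rewrite /canal_coef j0 /= expr0.
  by apply: forall_ord4_neq0; rewrite mul1r.
have [_ _ /negbTE nj /negbTE nnj /negbTE nnn] := cyc_next_neq j0.
(* the sign selects the sheet of the hyperboloid *)
pose b := c j < 0; pose c' i := (-1) ^+ b * c i.
rewrite e_other 1?eq_sym // => cq.
have [||t [w [cj cn cnn]]] :=
    @hyperboloid R (c' j) (c' (cyc_next j)) (c' (cyc_next (cyc_next j))).
- by rewrite !exprMn sqrr_sign !mul1r -sum_sign_cyc.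
- rewrite /c' /b; case: ltP => [/ltW|]; rewrite ?mul1r //.
  by rewrite mulN1r oppr_ge0.
exists b, t, w; apply: (forall_ord4_cyc j0) => //; apply: (canRL (signrMK _));
  by rewrite -/(c' _) /canal_coef (negbTE j0) ?eqxx ?nj ?nnj ?nnn.
Qed.

(** One nappe of the null cone, as a graph over the plane of its two spacelike
    coordinates. *)
Definition null_coef (i : 'I_4) (s t w : R) : R :=
  if i == j then Num.sqrt (t ^+ 2 + w ^+ 2)
  else if i == cyc_next j then t else w.

Lemma null_coef_quadric s t w : j != 0 ->
  \sum_(i < 4 | i != 0) e i * null_coef i s t w ^+ 2 = 0.
Proof.
move=> j0; have [_ _ /negbTE nj /negbTE nnj /negbTE nnn] := cyc_next_neq j0.
rewrite sum_sign_cyc // /null_coef !eqxx nj nnj nnn.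
by rewrite sqr_sqrtr ?addr_ge0 ?sqr_ge0 //; ring.
Qed.

Lemma null_coef_surj (c : 'I_4 -> R) s : j != 0 ->
  \sum_(i < 4 | i != 0) e i * c i ^+ 2 = 0 ->
  exists (b : bool) t w,
    forall i, i != 0 -> c i = (-1) ^+ b * null_coef i s t w.
Proof.
move=> j0; have [_ _ /negbTE nj /negbTE nnj /negbTE nnn] := cyc_next_neq j0.
rewrite sum_sign_cyc // => cq; pose b := c j < 0.
exists b, ((-1) ^+ b * c (cyc_next j)).
exists ((-1) ^+ b * c (cyc_next (cyc_next j))).
apply: (forall_ord4_cyc j0) => //;
  rewrite /null_coef ?eqxx ?nj ?nnj ?nnn ?signrMK //.
rewrite !exprMn sqrr_sign !mul1r.
have -> : c (cyc_next j) ^+ 2 + c (cyc_next (cyc_next j)) ^+ 2 = c j ^+ 2.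
  by apply/eqP; rewrite -subr_eq0 -[X in _ == X]cq; apply/eqP; ring.
by rewrite sqrtr_sqr /b mulr_sign_norm.
Qed.

Lemma sum_sign0_eq0 (c : 'I_4 -> R) : j = 0 ->
  \sum_(i < 4 | i != 0) e i * c i ^+ 2 = 0 -> forall i, i != 0 -> c i = 0.
Proof.
move=> j0; rewrite sum_sign0 // => /eqP.
rewrite !paddr_eq0 ?addr_ge0 ?sqr_ge0 // !sqrf_eq0.
by move=> /andP[/andP[/eqP c1 /eqP c2] /eqP c3]; apply: forall_ord4_neq0.
Qed.
End Quadrics.

(** * Canal hypersurfaces of a Frenet curve *)

Section FrenetCurve.
Variables (R : realType) (I : set R) (eps : 'I_4 -> R).
Variables (beta : R -> 'rV[R]_4) (F : 'I_4 -> R -> 'rV[R]_4).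
Variables (k1 k2 k3 r : R -> R) (s : R).
Hypothesis beta_frenet : frenet_curve I eps beta F k1 k2 k3.
Hypothesis r_smooth : smooth_on I (r : R -> R^o).
Hypothesis Is : I s.

Lemma frenet_sign_sq i : eps i * eps i = 1.
Proof. by case: (causal_sign beta_frenet i) => ->; rewrite ?mulrNN mul1r. Qed.

Lemma frenet_frame_orth i l :
  minkowski (F i s) (F l s) = eps i *+ (i == l).
Proof.
by case: eqVneq => [<-|il]; [exact: (frame_norm beta_frenet) |
  rewrite (frame_orth beta_frenet)].
Qed.

Lemma frenet_is_derive : is_derive s 1 beta (F 0 s).
Proof.
split; first exact: (@smooth_curve _ _ _ _ _ _ _ _ beta_frenet 0%N).
by rewrite -derive1E (tangent beta_frenet).
Qed.

Lemma radius_is_derive : is_derive s 1 (r : R -> R^o) (derive1 r s).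
Proof. by split; [exact: (@r_smooth 0%N s Is) | rewrite derive1E]. Qed.

Lemma characteristic_frenetE lambda m (a : 'I_4 -> R) :
  characteristic (quadric_family beta r lambda) s
    (beta s - (lambda * eps 0 * r s * derive1 r s) *: F 0 s
       - m *: \sum_(i < 4 | i != 0) a i *: F i s) <->
  m ^+ 2 * \sum_(i < 4 | i != 0) eps i * a i ^+ 2 =
  lambda * r s ^+ 2 - eps 0 * (lambda * eps 0 * r s * derive1 r s) ^+ 2.
Proof.
exact: (@characteristic_frameE _ _ _ _ _ _ _ (F^~ s) (@frenet_sign_sq)
  (@frenet_frame_orth) frenet_is_derive radius_is_derive).
Qed.

Lemma characteristic_frenet_coef lambda m x : m != 0 ->
  characteristic (quadric_family beta r lambda) s x ->
  x = beta s - (lambda * eps 0 * r s * derive1 r s) *: F 0 s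
      - m *: \sum_(i < 4 | i != 0)
               frame_coef eps (F^~ s) m (x - beta s) i *: F i s.
Proof.
exact: (@characteristic_frame_coef _ _ _ _ _ _ _ (F^~ s) (@frenet_sign_sq)
  (@frenet_frame_orth) frenet_is_derive radius_is_derive).
Qed.

(** The factor of the normal part in the formula for the canal hypersurface,
    which has the sign selected by b. *)
Definition canal_radius (lambda : R) (b : bool) : R :=
  (-1) ^+ b * (r s * Num.sqrt (derive1 r s ^+ 2 - lambda * eps 0)).

Section CanalRadius.
Variables (lambda : R) (b : bool).
Hypothesis lambda_sq : lambda * lambda = 1.
Hypothesis dr_gt : lambda * eps 0 < derive1 r s ^+ 2.
Hypothesis r_gt0 : 0 < r s.

Lemma canal_radius_neq0 : canal_radius lambda b != 0.
Proof.
rewrite mulf_neq0 ?signr_eq0 // mulf_neq0 ?gt_eqF // sqrtr_gt0.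
by rewrite subr_gt0.
Qed.

(** The right-hand side of the equation of normal coordinates is
    - eps_1 times the square of the scale, because the squares of lambda and
    eps_1 are 1. *)
Lemma characteristic_canalE (c : 'I_4 -> R) :
  characteristic (quadric_family beta r lambda) s
    (beta s - (lambda * eps 0 * r s * derive1 r s) *: F 0 s
       - canal_radius lambda b *: \sum_(i < 4 | i != 0) c i *: F i s) <->
  \sum_(i < 4 | i != 0) eps i * c i ^+ 2 = - eps 0.
Proof.
rewrite characteristic_frenetE.
have m2 : canal_radius lambda b ^+ 2 =
    r s ^+ 2 * (derive1 r s ^+ 2 - lambda * eps 0).
  rewrite exprMn sqrr_sign mul1r exprMn sqr_sqrtr //.
  by rewrite ltW // subr_gt0.
have -> : lambda * r s ^+ 2 - eps 0 * (lambda * eps 0 * r s * derive1 r s) ^+ 2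
    = canal_radius lambda b ^+ 2 * - eps 0.
  rewrite m2; transitivity (lambda * r s ^+ 2
    - eps 0 * (eps 0 * eps 0) * (lambda * lambda) * (r s * derive1 r s) ^+ 2).
    by ring.
  rewrite frenet_sign_sq lambda_sq !mulr1 -[lambda * r s ^+ 2]mulr1.
  by rewrite -(frenet_sign_sq 0); ring.
split=> [|-> //]; apply: mulfI.
by rewrite sqrf_eq0 canal_radius_neq0.
Qed.

End CanalRadius.

Lemma characteristic_nullE a b t w :
  characteristic (quadric_family beta r 0) s (null_canal beta F a b s t w) <->
  \sum_(i < 4 | i != 0) eps i * a i s t w ^+ 2 = 0.
Proof.
have := characteristic_frenetE 0 ((-1) ^+ b) (fun i => a i s t w).
by rewrite !mul0r scale0r expr0n mulr0 !subr0 sqrr_sign mul1r.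
Qed.

Lemma characteristic_null_coef (b : bool) x :
  characteristic (quadric_family beta r 0) s x ->
  x = beta s - (-1) ^+ b *: \sum_(i < 4 | i != 0)
               frame_coef eps (F^~ s) ((-1) ^+ b) (x - beta s) i *: F i s.
Proof.
move=> /(@characteristic_frenet_coef _ ((-1) ^+ b)).
by rewrite signr_eq0 !mul0r scale0r subr0; apply.
Qed.
End FrenetCurve.

Unset Implicit Arguments.

Theorem theorem1 (R : realType) (j : 'I_4) (I : set R) (eps : 'I_4 -> R)
    (beta : R -> 'rV[R]_4) (F : 'I_4 -> R -> 'rV[R]_4)
    (k1 k2 k3 : R -> R) (r : R -> R)
    (I_open : open I) (I_interval : is_interval I)
    (beta_frenet : frenet_curve I eps beta F k1 k2 k3)
    (eps_j : eps j = -1) (eps_other : forall i, i != j -> eps i = 1)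
    (r_smooth : smooth_on I (r : R -> R^o))
    (r_pos : forall s, I s -> 0 < r s) :
  (forall lambda : R, lambda = 1 \/ lambda = -1 ->
     (forall s, I s -> lambda * eps 0 < derive1 r s ^+ 2) ->
     parametrizes_envelope I (quadric_family beta r lambda)
       (canal j lambda eps beta F r))
  /\
  (j != 0 ->
     (forall (b : bool) (X : R -> R -> R -> 'rV[R]_4),
        adapted I (quadric_family beta r 0) X <->
        exists2 a : 'I_4 -> R -> R -> R -> R,
          isotropic_coef I eps a &
          forall s t w, I s -> X s t w = null_canal beta F a b s t w)
     /\
     exists2 a : 'I_4 -> R -> R -> R -> R,
       isotropic_coef I eps a &
       parametrizes_envelope I (quadric_family beta r 0) (null_canal beta F a))
  /\
  (j = 0 ->
     (forall a : 'I_4 -> R -> R -> R -> R, isotropic_coef I eps a ->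
        forall i s t w, i != 0 -> I s -> a i s t w = 0)
     /\ envelope I (quadric_family beta r 0) = beta @` I).
Proof.
split; [|split].
- move=> lambda lambda_pm dr_gt.
  have ll : lambda * lambda = 1 by case: lambda_pm => ->; rewrite ?mulrNN mul1r.
  have canalE s b (Is : I s) := characteristic_canalE
    beta_frenet r_smooth Is b ll (dr_gt s Is) (r_pos s Is).
  have canal_adapted b : adapted I (quadric_family beta r lambda)
      (canal j lambda eps beta F r b).
    move=> s t w Is; apply/(canalE s b Is).
    exact: canal_coef_quadric.
  split=> //; apply/seteqP; split=> x /=; last first.
    by move=> [b [s [t [w [Is ->]]]]]; exists s => //; exact: canal_adapted.
  move=> [s Is char_x].
  have m0 := canal_radius_neq0 false (dr_gt s Is) (r_pos s Is).
  have xE := characteristic_frenet_coef beta_frenet r_smooth Is m0 char_x.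
  (* the normal coordinates read off with one fixed sign solve the quadratic
     equation, and its parametrization supplies the sign that is needed *)
  move: char_x; rewrite xE => /(canalE s false Is).
  move=> /(canal_coef_surj eps_j eps_other s) [b [t [w cE]]].
  exists b, s, t, w; split=> //; rewrite /canal /normal_part.
  congr (_ - _); rewrite !scaler_sumr; apply: eq_bigr => i i0.
  by rewrite cE // !scalerA; congr (_ *: _); rewrite /canal_radius expr0; ring.
- move=> j0; have nullE a s b t w (Is : I s) :=
    characteristic_nullE beta_frenet r_smooth Is a b t w.
  have null_coef_x s b x (Is : I s) := characteristic_null_coef
    beta_frenet r_smooth Is b (x := x).
  split=> [b X|].
    split=> [X_adapted|[a a_iso XE] s t w Is]; last first.
      by rewrite XE //; apply/nullE => //; exact: a_iso.
    (* the sign is its own inverse, so either sign reaches every adapted X *)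
    pose a i s t w :=
      frame_coef eps (F^~ s) ((-1) ^+ b) (X s t w - beta s) i.
    have XE s t w : I s -> X s t w = null_canal beta F a b s t w.
      by move=> Is; apply: null_coef_x (X_adapted s t w Is).
    exists a => // s t w Is; apply/(nullE a s b t w Is).
    by rewrite -XE //; exact: X_adapted.
  (* the two signs give the two nappes of the cone *)
  exists (@null_coef R j) => [s t w Is|]; first exact: null_coef_quadric.
  have null_adapted b : adapted I (quadric_family beta r 0)
      (null_canal beta F (@null_coef R j) b).
    by move=> s t w Is; apply/nullE => //; exact: null_coef_quadric.
  split=> //; apply/seteqP; split=> x /=; last first.
    by move=> [b [s [t [w [Is ->]]]]]; exists s => //; exact: null_adapted.
  move=> [s Is char_x]; have xE := null_coef_x s false x Is char_x.
  pose a i (_ _ _ : R) :=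
    frame_coef eps (F^~ s) ((-1) ^+ false) (x - beta s) i.
  move: char_x; rewrite xE => /(nullE a s false 0 0 Is).
  move=> /(null_coef_surj eps_j eps_other s j0) [b [t [w cE]]].
  exists b, s, t, w; split=> //; rewrite /null_canal /normal_part.
  congr (_ - _); rewrite !scaler_sumr; apply: eq_bigr => i i0.
  by rewrite [frame_coef _ _ _ _ _]cE // !scalerA expr0 mul1r.
- move=> j0; have a0 a : isotropic_coef I eps a ->
      forall i s t w, i != 0 -> I s -> a i s t w = 0.
    move=> a_iso i s t w i0 Is.
    exact: (sum_sign0_eq0 eps_other (c := fun l => a l s t w) j0
      (a_iso s t w Is)).
  split=> //.
  have nullE a s b t w (Is : I s) :=
    characteristic_nullE beta_frenet r_smooth Is a b t w.
  have vertex s x : I s ->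
      characteristic (quadric_family beta r 0) s x <-> x = beta s.
    move=> Is; split=> [char_x|->].
      have xE := characteristic_null_coef
        beta_frenet r_smooth Is false char_x.
      pose a i (_ _ _ : R) :=
        frame_coef eps (F^~ s) ((-1) ^+ false) (x - beta s) i.
      move: (char_x); rewrite {1}xE => /(nullE a s false 0 0 Is).
      move=> /(sum_sign0_eq0 eps_other j0) c0.
      rewrite xE big1 ?scaler0 ?subr0 // => i i0.
      by rewrite [frame_coef _ _ _ _ _]c0 // scale0r.
    have := nullE (fun _ _ _ _ => 0) s false 0 0 Is.
    rewrite /null_canal /normal_part.
    rewrite big1 ?scaler0 ?subr0; last by move=> i _; rewrite scale0r.
    by move=> ->; rewrite big1 // => i _; rewrite expr0n mulr0.
  apply/seteqP; split=> x /=.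
    by move=> [s Is /(vertex _ _ Is) ->]; exists s.
  by move=> [s Is <-]; exists s => //; apply/vertex.
Qed.
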